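(* Let $d\ge 1$ be an integer and let $1<p\le 1+\frac{2}{d}$ be real. Let $N_0$ be a positive integer, $\delta=1/N_0$, $h>0$, and let $u_n^{(i)}$ ($n\ge N_0$, $i\in\mathbb{Z}^d$) be the real-valued solution of the discrete initial value problem $$ u^{(i)}_{n+1}=\frac{\delta^2}{h^2}v_n^{(i)}+\left(2-2d\frac{\delta^2}{h^2}\right)u_n^{(i)}-u_{n-1}^{(i)}+\delta^{2-p}|u_n^{(i)}|^{p-1}\tan\left(\delta\frac{|u_n^{(i)}|}{n^{p-1}}\right),\qquad n>N_0,\ i\in\mathbb{Z}^d, $$ where $v_n^{(i)}:=\sum_{j=1}^d\left(u_n^{(i+e_j)}+u_n^{(i-e_j)}\right)$, with initial data $$ u_{N_0}^{(i)}=f(x_i),\qquad u_{N_0+1}^{(i)}=u_{N_0}^{(i)}+\delta g(x_i),\qquad x_i=hi,\ i\in\mathbb{Z}^d . $$ Assume that there exists a positive integer $R$ such that $$ \{i\in\mathbb{Z}^d: u_n^{(i)}\neq 0,\ n=N_0,N_0+1\}\subset\{i\in\mathbb{Z}^d:\|i\|_1\le R\} $$ (that is, both $u_{N_0}^{(i)}$ and $u_{N_0+1}^{(i)}$ vanish whenever $\|i\|_1>R$), that $$ \sum_{i\in\mathbb{Z}^d}u_{N_0}^{(i)}\ge 0, $$ and that there exists a positive constant $I$ such that $$ \sum_{i\in\mathbb{Z}^d}\left(u_{N_0+1}^{(i)}-u_{N_0}^{(i)}\right)>I . $$ Then the solution $u_n^{(i)}$ blows up in finite time.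
   Context: Here $e_j\in\mathbb{Z}^d$ is the unit vector whose $j$-th component is $1$ and whose other components are $0$; $\|i\|_1:=|i_1|+\cdots+|i_d|$ for $i=(i_1,\dots,i_d)\in\mathbb{Z}^d$; $f,g$ are given real-valued functions on $\mathbb{R}^d$ (only their values on the grid $h\mathbb{Z}^d$ matter). Definition of blow-up: the solution $u_n^{(i)}$ is said to blow up in finite time if there exist an integer $N_b\ge N_0$ and a vector $i_b\in\mathbb{Z}^d$ such that $|u_{N_b}^{(i_b)}|\ge\frac{\pi}{2}\delta^{-1}N_b^{p-1}$. (As long as $|u_n^{(i)}|<\frac{\pi}{2}\delta^{-1}n^{p-1}$ for all $i$, the argument of the tangent lies in $[0,\pi/2)$, and the recursion determines $u_{n+1}^{(i)}$.) *)

(* Defs.v *)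
From HB Require Import structures.
From mathcomp Require Import all_boot all_order all_algebra.
From mathcomp Require Import all_classical all_reals all_analysis.

Set Implicit Arguments.
Unset Strict Implicit.
Unset Printing Implicit Defensive.

Import Order.TTheory GRing.Theory Num.Theory.
Import numFieldNormedType.Exports.

Local Open Scope classical_set_scope.
Local Open Scope ring_scope.

Definition l1norm (d : nat) (i : 'rV[int]_d) : nat :=
  (\sum_(j < d) `|i ord0 j|)%N.

Definition grid_point (R : realType) (d : nat) (h : R) (i : 'rV[int]_d) :
    'rV[R]_d :=
  \row_j (h * (i ord0 j)%:~R).

(* [delta_mx ord0 j] is the unit vector e_j. *)
Definition neighbour_sum (R : realType) (d : nat) (w : 'rV[int]_d -> R)
    (i : 'rV[int]_d) : R :=
  \sum_(j < d) (w (i + delta_mx ord0 j) + w (i - delta_mx ord0 j)).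

Definition blowup_threshold (R : realType) (delta p : R) (n : nat) : R :=
  pi / 2 * delta^-1 * n%:R `^ (p - 1).

Definition blows_up (R : realType) (d N0 : nat) (delta p : R)
    (u : nat -> 'rV[int]_d -> R) : Prop :=
  exists (Nb : nat) (ib : 'rV[int]_d),
    (N0 <= Nb)%N /\ blowup_threshold delta p Nb <= `|u Nb ib|.

Definition below_threshold (R : realType) (d N0 : nat) (delta p : R)
    (u : nat -> 'rV[int]_d -> R) (n : nat) : Prop :=
  forall m : nat, (N0 <= m <= n)%N ->
  forall i : 'rV[int]_d, `|u m i| < blowup_threshold delta p m.

(* The recursion is imposed only as long as the threshold has not been reached,
   i.e. while the argument of [tan] lies in [0, pi/2[: the values of [u] after
   a blow-up, where the library's total [tan] is not meaningful, are
   unconstrained, and so are the values of [u] before N0. *)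
Definition is_solution (R : realType) (d N0 : nat) (delta h p : R)
    (f g : 'rV[R]_d -> R) (u : nat -> 'rV[int]_d -> R) : Prop :=
  [/\ forall i, u N0 i = f (grid_point h i),
      forall i, u N0.+1 i = u N0 i + delta * g (grid_point h i)
    & forall n : nat, (N0 < n)%N -> below_threshold N0 delta p u n ->
      forall i : 'rV[int]_d,
      u n.+1 i =
        delta ^+ 2 / h ^+ 2 * neighbour_sum (u n) i
        + (2 - 2 * d%:R * (delta ^+ 2 / h ^+ 2)) * u n i
        - u n.-1 i
        + delta `^ (2 - p) * `|u n i| `^ (p - 1)
          * tan (delta * (`|u n i| / n%:R `^ (p - 1)))].

(* Main.v *)
Require Import Defs.
From HB Require Import structures.
From mathcomp Require Import all_boot all_order all_algebra.
From mathcomp Require Import all_classical all_reals all_analysis.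
From mathcomp Require Import ring lra zify.

Set Implicit Arguments.
Unset Strict Implicit.
Unset Printing Implicit Defensive.

Import Order.TTheory GRing.Theory Num.Theory.
Import numFieldNormedType.Exports.

Local Open Scope classical_set_scope.
Local Open Scope ring_scope.

(** The proof is a discrete form of Kato's argument for semilinear wave
    equations, applied to the spatial sum U_n of u_n.  Suppose that there is no
    blow-up; then the recursion holds for all times.  Write s = p - 1.

    The discrete Laplacian sums to zero over the lattice, so the second
    difference of U is the sum of the nonlinear term
    ([lattice_sum_second_difference]).  Since tan x >= x, this term is at least
    a constant times n^(-s) |u|^(1+s).  Waves travel one site per step
    ([finite_propagation]), so u_n lives on a cube with O(n^d) sites.  By
    convexity the sum of |u_n|^(1+s) is smallest, for a given U_n, when u_n is
    spread evenly over these sites, so it is at least a constant times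
    n^(-ds) U_n^(1+s) ([sum_power_ge]).  The assumption p <= 1 + 2/d says
    exactly that ds <= 2, which gives ([sum_nonlinearity_ge])
      U_{n+1} - 2 U_n + U_{n-1} >= c n^(-2) (U_n / n)^s U_n.

    This inequality, with U >= 0 and a positive initial velocity, keeps U from
    being bounded by a polynomial ([kato_no_global_solution]).  On the other hand,
    the values of u_n stay below the threshold, which is O(n^s), and there are
    O(n^d) sites, so U_n = O(n^(d+2)): a contradiction.

    The case ds = 2 is still covered because the last inequality is invariant
    when n and U are scaled by the same factor: the velocity D of U satisfies
    D_{4n} >= D_n + const * D_n^(1+s), with a constant that does not depend
    on n.  Along n = 4^k N the velocity thus grows faster than every geometric
    sequence, while a polynomial in n is only geometric in k. *)

(** * Superlinear growth and the discrete Kato lemma *)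

(** The increments are bounded below, so y is unbounded; once c y^s exceeds 2B,
    each step multiplies y by at least 2B, which beats the ratio B. *)
Lemma superlinear_growth (R : realType) (y : nat -> R) (c s C B : R) :
  0 < c -> 0 < s -> 0 < B -> 0 < y 0%N ->
  (forall k, y k + c * y k `^ s * y k <= y k.+1) ->
  ~ (forall k, y k <= C * B ^+ k).
Proof.
move=> c0 s0 B0 y0 step bound.
have y_ge k : y 0%N <= y k.
  elim: k => // k IH; have yk := lt_le_trans y0 IH.
  apply: (le_trans IH); apply: le_trans (step k).
  by rewrite lerDl !mulr_ge0 ?powR_ge0 // ltW.
have y_gt0 k : 0 < y k := lt_le_trans y0 (y_ge k).
have pow_mono a b : 0 <= a -> a <= b -> a `^ s <= b `^ s.
  by move=> a0 ab; apply: ge0_ler_powR; rewrite ?nnegrE ?(le_trans a0 ab)// ltW.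
have y_lin k : k%:R * (c * y 0%N `^ s * y 0%N) <= y k.
  elim: k => [|k IH]; first by rewrite mul0r ltW.
  apply: le_trans (step k); rewrite -natr1 mulrDl mul1r lerD//.
  by rewrite ler_pM ?mulr_ge0 ?powR_ge0 ?ler_pM2l ?pow_mono// ltW.
have [k0 yk0] : exists k0, 2 * B <= c * y k0 `^ s.
  set Y := (2 * B / c) `^ s^-1.
  set a := c * y 0%N `^ s * y 0%N.
  have a0 : 0 < a by rewrite !mulr_gt0 ?powR_gt0.
  exists (Num.bound (Y / a)).
  have B2c : 0 <= 2 * B / c by rewrite divr_ge0 ?mulr_ge0// ltW.
  have YE : Y `^ s = 2 * B / c.
    by rewrite -powRrM mulVf ?gt_eqF// powRr1.
  rewrite [leRHS]mulrC -ler_pdivrMr// -YE pow_mono ?powR_ge0//.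
  apply: le_trans (y_lin _); rewrite -/a -ler_pdivrMr//.
  by apply/ltW/archi_boundP; rewrite divr_ge0 ?powR_ge0// ltW.
have y_geom j : (2 * B) ^+ j * y k0 <= y (k0 + j)%N.
  elim: j => [|j IH]; first by rewrite mul1r addn0.
  rewrite addnS; apply: le_trans (step _).
  apply: (@le_trans _ _ (c * y (k0 + j)%N `^ s * y (k0 + j)%N)); last first.
    by rewrite lerDr ltW.
  have yk0j : y k0 <= y (k0 + j)%N.
    elim: (j) => [|i IHi]; first by rewrite addn0.
    rewrite addnS; apply: (le_trans IHi); apply: le_trans (step _).
    by rewrite lerDl !mulr_ge0 ?powR_ge0// ltW.
  rewrite exprS -mulrA ler_pM ?mulr_ge0 ?exprn_ge0 ?mulr_ge0//; try exact: ltW.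
  by apply: (le_trans yk0); rewrite ler_pM2l// pow_mono// ltW.
pose j := Num.bound (`|C * B ^+ k0| / y k0).
have hj : `|C * B ^+ k0| < j%:R * y k0.
  by rewrite -ltr_pdivrMr//; apply: archi_boundP; rewrite divr_ge0// ltW.
have /(le_trans (y_geom j)) := bound (k0 + j)%N.
rewrite exprD exprMn mulrA [_ * B ^+ j * _]mulrAC ler_pM2r ?exprn_gt0//.
apply/negP; rewrite -ltNge; apply: (le_lt_trans (ler_norm _)).
apply: (lt_trans hj); rewrite ltr_pM2r// -natrX ltr_nat.
exact: ltn_expl.
Qed.

(** Let D be the first difference of U; it is positive and nondecreasing, so
    U_m >= (m - n) D_n.  For 2n < m <= 4n this gives U_m >= n D_n and
    U_m / m >= D_n / 4, so each of the 2n second differences in this range is at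
    least a constant times D_n^(1+s) / n.  Their sum no longer depends on n, and
    [superlinear_growth] applies to D along the times 4^k N. *)
Lemma kato_no_global_solution (R : realType) (U : nat -> R) (N m : nat)
    (c s C : R) :
  (0 < N)%N -> 0 < c -> 0 < s -> 0 <= U N -> U N < U N.+1 ->
  (forall n, (N <= n)%N -> 0 <= U n.+1 ->
     c * (U n.+1 / n.+1%:R) `^ s * U n.+1 / n.+1%:R ^+ 2
       <= (U n.+2 - U n.+1) - (U n.+1 - U n)) ->
  ~ (forall n, (N <= n)%N -> U n <= C * n%:R ^+ m).
Proof.
move=> N0 c0 s0 UN0 DN0 conv bound.
pose D n := U n.+1 - U n.
have UD n : U n.+1 = U n + D n by rewrite /D addrCA subrr addr0.
have step n : (N <= n)%N -> 0 <= U n.+1 -> D n <= D n.+1.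
  move=> Nn Un; rewrite -subr_ge0; apply: le_trans (conv n Nn Un).
  by rewrite divr_ge0 ?exprn_ge0// !mulr_ge0 ?powR_ge0// ltW.
have pos k : 0 <= U (N + k)%N /\ 0 < D (N + k)%N.
  elim: k => [|k [IH1 IH2]]; first by rewrite addn0 UN0 /D subr_gt0.
  have U1 : 0 <= U (N + k).+1 by rewrite UD addr_ge0// ltW.
  by rewrite addnS; split=> //; apply: lt_le_trans IH2 (step _ _ U1); rewrite leq_addr.
have U_ge0 n : (N <= n)%N -> 0 <= U n by move=> /subnKC <-; case: (pos (n - N)%N).
have D_gt0 n : (N <= n)%N -> 0 < D n by move=> /subnKC <-; case: (pos (n - N)%N).
have D_mono n k : (N <= n)%N -> D n <= D (n + k)%N.
  move=> Nn; elim: k => [|k IH]; first by rewrite addn0.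
  by rewrite addnS; apply: (le_trans IH); apply: step; [|apply: U_ge0]; lia.
have U_lin n k : (N <= n)%N -> k%:R * D n <= U (n + k)%N.
  move=> Nn; elim: k => [|k IH]; first by rewrite mul0r addn0 U_ge0.
  by rewrite addnS UD -natr1 mulrDl mul1r lerD// D_mono.
have pow_mono a b : 0 <= a -> a <= b -> a `^ s <= b `^ s.
  by move=> a0 ab; apply: ge0_ler_powR; rewrite ?nnegrE ?(le_trans a0 ab)// ltW.
(* The powers of 4 in q come from U_m / m >= D_n / 4 and m^2 <= 16 n^2. *)
pose q := c * 4^-1 `^ s / 16.
have q0 : 0 < q by rewrite divr_gt0// mulr_gt0// powR_gt0// invr_gt0.
have quad n k : (N <= n)%N -> (k <= 2 * n)%N ->
    D n + k%:R * (q * D n `^ s * D n / n%:R) <= D (2 * n + k)%N.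
  move=> Nn; have Dn := D_gt0 n Nn.
  have nR : 0 < n%:R :> R by rewrite ltr0n; lia.
  elim: k => [_|k IH kn].
    by rewrite mul0r addr0 addn0 mul2n -addnn D_mono.
  have /IH {}IH : (k <= 2 * n)%N by lia.
  rewrite addnS; set l := (2 * n + k)%N in IH *.
  have Nl : (N <= l)%N by rewrite /l; lia.
  have lR : 0 < l.+1%:R :> R by rewrite ltr0n.
  have l4 : l.+1%:R <= 4 * n%:R :> R by rewrite -natrM ler_nat /l; lia.
  have Ul : n%:R * D n <= U l.+1.
    have := U_lin n (l.+1 - n)%N Nn.
    rewrite subnKC; last by rewrite /l; lia.
    by apply: le_trans; rewrite ler_pM2r// ler_nat /l; lia.
  have := conv l Nl (U_ge0 _ (leqW Nl)); rewrite -/(D l) -/(D l.+1) => cl.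
  rewrite -natr1 mulrDl mul1r addrA.
  suff dq : q * D n `^ s * D n / n%:R
      <= c * (U l.+1 / l.+1%:R) `^ s * U l.+1 / l.+1%:R ^+ 2.
    by rewrite -(subrK (D l) (D l.+1)) addrC lerD// (le_trans dq).
  have D4 : D n / 4 <= U l.+1 / l.+1%:R.
    rewrite ler_pdivlMr//; apply: le_trans Ul.
    by rewrite [n%:R * _]mulrC -mulrA ler_pM2l// ler_pdivrMl.
  have -> : q * D n `^ s * D n / n%:R
      = c * (D n / 4) `^ s * (n%:R * D n) / (4 * n%:R) ^+ 2.
    rewrite powRM ?invr_ge0// ?(ltW Dn)// /q; field.
    by rewrite gt_eqF.
  have Dn0 := ltW Dn; have c0' := ltW c0; have nR' := ltW nR.
  rewrite ler_pM ?mulr_ge0 ?invr_ge0 ?exprn_ge0 ?powR_ge0//.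
  - rewrite ler_pM ?mulr_ge0 ?powR_ge0// ler_pM2l//.
    by rewrite pow_mono// divr_ge0.
  - rewrite lef_pV2 ?posrE ?exprn_gt0 ?mulr_gt0//.
    by rewrite ler_pXn2r ?nnegrE ?mulr_ge0// ltW.
have NR : 0 < N%:R :> R by rewrite ltr0n.
pose y k := D (4 ^ k * N)%N.
have N4 k : (N <= 4 ^ k * N)%N by rewrite leq_pmull// expn_gt0.
apply: (@superlinear_growth _ y (2 * q) s (`|C| * (2 * N%:R) ^+ m) (4 ^+ m)) => //.
- by rewrite mulr_gt0.
- by rewrite /y expn0 mul1n D_gt0.
- move=> k; have := quad (4 ^ k * N)%N (2 * (4 ^ k * N))%N (N4 k) (leqnn _).
  rewrite -/(y k) (_ : 2 * _ + 2 * _ = 4 ^ k.+1 * N)%N; last by rewrite expnS; lia.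
  rewrite -/(y k.+1); apply: le_trans.
  have nR : 0 < (4 ^ k * N)%:R :> R by rewrite ltr0n (leq_trans N0 (N4 k)).
  rewrite lerD2l natrM le_eqVlt; apply/orP; left; apply/eqP.
  move: (_%:R) nR => t t0; field.
  by rewrite gt_eqF.
- move=> k; have Nn := N4 k; set n := (4 ^ k * N)%N in Nn.
  apply: (@le_trans _ _ (U n.+1)).
    by rewrite UD lerDr U_ge0.
  apply: (le_trans (bound _ (leqW Nn))).
  apply: (@le_trans _ _ (`|C| * n.+1%:R ^+ m)).
    by rewrite ler_wpM2r ?exprn_ge0// ler_norm.
  rewrite -mulrA ler_wpM2l// exprAC -exprMn lerXn2r ?nnegrE ?mulr_ge0 ?exprn_ge0//.
  by rewrite -natrX -!natrM ler_nat /n; lia.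
Qed.

(** * Sums over the lattice of functions supported in a cube *)

Definition supported_in_cube (R : realType) (d : nat) (k : nat)
    (w : 'rV[int]_d -> R) : Prop :=
  forall (i : 'rV[int]_d) (j : 'I_d), (k < `|i ord0 j|)%N -> w i = 0.

(** An explicit enumeration, which makes the number of sites computable and
    turns the sum over the whole lattice into a sum over a sequence. *)
Definition cube (d k : nat) : seq 'rV[int]_d :=
  [seq \row_j ((phi j : nat)%:Z - k%:Z) | phi : {ffun 'I_d -> 'I_(k.*2.+1)}].

Lemma size_cube d k : size (cube d k) = (k.*2.+1 ^ d)%N.
Proof. by rewrite size_map -cardE card_ffun !card_ord. Qed.

Lemma cube_uniq d k : uniq (cube d k).
Proof.
rewrite map_inj_uniq ?enum_uniq// => phi psi /rowP eq_rows.
apply/ffunP => j; apply/val_inj.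
by have := eq_rows j; rewrite !mxE => /addIr [].
Qed.

Lemma mem_cube d k (i : 'rV[int]_d) :
  (forall j, (`|i ord0 j| <= k)%N) -> i \in cube d k.
Proof.
move=> ik; apply/mapP; exists [ffun j => inord `|(i ord0 j + k%:Z)%R|%N].
  by rewrite mem_enum.
apply/rowP => j; rewrite !mxE ffunE.
by move: (i 0%R j) (ik j : `|i 0%R j| <= k)%N => z zk; rewrite inordK; lia.
Qed.

Lemma supported_widen (R : realType) d k l (w : 'rV[int]_d -> R) :
  (k <= l)%N -> supported_in_cube k w -> supported_in_cube l w.
Proof. by move=> kl wk i j lj; apply: (wk i j); apply: leq_ltn_trans lj. Qed.

(** The left-hand side does not depend on k, so several functions can be summed
    over one cube that is large enough for all of them. *)
Lemma lattice_sumE (R : realType) d k (w : 'rV[int]_d -> R) :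
  supported_in_cube k w ->
  \sum_(i \in [set: 'rV[int]_d]) w i = \sum_(i <- cube d k) w i.
Proof.
move=> wk; rewrite [RHS]fsbig_seq ?cube_uniq//; symmetry; apply: fsbig_widen => //.
move=> i [_ /= ik]; apply/eqP/negPn/negP => wi; apply: ik; apply: mem_cube => j.
by rewrite leqNgt; apply: contraNN wi => /wk ->.
Qed.

Lemma lattice_sum_shift (R : realType) d (w : 'rV[int]_d -> R) (e : 'rV[int]_d) :
  \sum_(i \in [set: 'rV[int]_d]) w (i + e) = \sum_(i \in [set: 'rV[int]_d]) w i.
Proof.
rewrite [RHS](reindex_fsbigT (fun i => i + e))//.
by exists (fun i => i - e) => i; rewrite ?addrK ?subrK.
Qed.

Lemma supported_shift (R : realType) d k (w : 'rV[int]_d -> R) (e : 'rV[int]_d) :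
  (forall j, (`|e ord0 j| <= 1)%N) -> supported_in_cube k w ->
  supported_in_cube k.+1 (fun i => w (i + e)).
Proof.
move=> e1 wk i j kj; apply: (wk _ j); rewrite mxE.
by move: (i _ j) (e _ j) kj (e1 j) => a b; lia.
Qed.

Lemma unit_vector_le1 d (j l : 'I_d) :
  (`|(delta_mx ord0 j : 'rV[int]_d) ord0 l| <= 1)%N /\
  (`|(- delta_mx ord0 j : 'rV[int]_d) ord0 l| <= 1)%N.
Proof. by rewrite !mxE eqxx /=; case: (l == j). Qed.

Lemma supported_neighbour_sum (R : realType) d k (w : 'rV[int]_d -> R) :
  supported_in_cube k w -> supported_in_cube k.+1 (neighbour_sum w).
Proof.
move=> wk i l kl; rewrite /neighbour_sum big1// => j _.
rewrite (supported_shift _ wk kl) => [|m]; last by case: (unit_vector_le1 j m).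
rewrite (supported_shift _ wk kl) ?addr0// => m.
by case: (unit_vector_le1 j m).
Qed.

(** Summation by parts: it makes the discrete Laplacian
    neighbour_sum w - 2 d w sum to zero. *)
Lemma lattice_sum_neighbour (R : realType) d k (w : 'rV[int]_d -> R) :
  supported_in_cube k w ->
  \sum_(i \in [set: 'rV[int]_d]) neighbour_sum w i
    = 2 * d%:R * \sum_(i \in [set: 'rV[int]_d]) w i.
Proof.
move=> wk; rewrite (lattice_sumE (supported_neighbour_sum wk)).
rewrite /neighbour_sum exchange_big /=.
rewrite (eq_bigr (fun=> 2 * \sum_(i \in [set: 'rV[int]_d]) w i)) => [|j _].
  by rewrite sumr_const card_ord -mulr_natr; ring.
rewrite big_split /=.
have shiftE e : (forall l, (`|(e : 'rV[int]_d) ord0 l| <= 1)%N) ->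
    \sum_(i <- cube d k.+1) w (i + e) = \sum_(i \in [set: 'rV[int]_d]) w i.
  by move=> e1; rewrite -(lattice_sumE (supported_shift e1 wk)) lattice_sum_shift.
rewrite !shiftE => [|l|l]; try by case: (unit_vector_le1 j l).
by ring.
Qed.

(** * Propagation of the support and evolution of the lattice sum *)

(** The recursion reads only nearest neighbours, so the support grows by at most
    one site per step. *)
Lemma finite_propagation (R : realType) d (a b : R) (F : nat -> R -> R)
    (u : nat -> 'rV[int]_d -> R) (N r : nat) :
  (forall n, F n 0 = 0) ->
  (forall n i, (N <= n)%N ->
     u n.+2 i = a * neighbour_sum (u n.+1) i + b * u n.+1 i - u n i
                + F n.+1 (u n.+1 i)) ->
  supported_in_cube r (u N) -> supported_in_cube r (u N.+1) ->
  forall n, (N <= n)%N -> supported_in_cube (r + n) (u n).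
Proof.
move=> F0 rec suppN suppN1.
suff pair k : supported_in_cube (r + k) (u (N + k)%N) /\
              supported_in_cube (r + k.+1) (u (N + k).+1).
  move=> n /subnKC <-; apply: supported_widen (pair _).1.
  by rewrite leq_add2l leq_addl.
elim: k => [|k [IH0 IH1]].
  by rewrite !addn0; split=> //; apply: supported_widen suppN1; rewrite leq_addr.
rewrite [(N + _)%N]addnS; split=> // i j kj.
have kj1 : (r + k.+1 < `|i ord0 j|)%N by apply: leq_ltn_trans kj; lia.
have kj0 : (r + k < `|i ord0 j|)%N by apply: leq_ltn_trans kj1; lia.
rewrite rec ?leq_addr// (IH1 _ _ kj1) (IH0 _ _ kj0) F0.
rewrite (supported_neighbour_sum IH1 (i := i) (j := j)); last by rewrite -addnS.
by rewrite !mulr0 !addr0 subr0.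
Qed.

(** The coefficient 2 - 2 d a is the one for which the linear part is
    2 w1 - w0 plus a times the discrete Laplacian of w1, which sums to zero. *)
Lemma lattice_sum_second_difference (R : realType) d k (a : R) (F : R -> R)
    (w0 w1 w2 : 'rV[int]_d -> R) :
  F 0 = 0 -> supported_in_cube k w0 -> supported_in_cube k w1 ->
  (forall i, w2 i = a * neighbour_sum w1 i + (2 - 2 * d%:R * a) * w1 i - w0 i
                    + F (w1 i)) ->
  (\sum_(i \in [set: 'rV[int]_d]) w2 i - \sum_(i \in [set: 'rV[int]_d]) w1 i)
  - (\sum_(i \in [set: 'rV[int]_d]) w1 i - \sum_(i \in [set: 'rV[int]_d]) w0 i)
  = \sum_(i <- cube d k.+1) F (w1 i).
Proof.
move=> F0 supp0 supp1 rec.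
have supp_nb := supported_neighbour_sum supp1.
have {}supp0 := supported_widen (leqnSn k) supp0.
have supp1' := supported_widen (leqnSn k) supp1.
have supp2 : supported_in_cube k.+1 w2.
  move=> i j kj; rewrite rec (supp0 _ _ kj) (supp1' _ _ kj) (supp_nb _ _ kj) F0.
  by rewrite !mulr0 !addr0 subr0.
have := lattice_sum_neighbour supp1.
rewrite (lattice_sumE supp_nb) (lattice_sumE supp0) (lattice_sumE supp1').
rewrite (lattice_sumE supp2) (eq_bigr _ (fun i _ => rec i)).
rewrite big_split sumrB big_split /= -!mulr_sumr => ->.
ring.
Qed.

(** * Lower bound for the summed nonlinearity *)

Lemma tan_ge_id (R : realType) (x : R) : 0 <= x -> x < pi / 2 -> x <= tan x.
Proof.
move=> x0 xpi.
have cos_pos z : 0 <= z -> z <= x -> 0 < cos z :> R.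
  move=> z0 zx; apply: cos_gt0_pihalf; rewrite (le_lt_trans zx xpi) andbT.
  by rewrite (lt_le_trans _ z0)// oppr_lt0 divr_gt0// pi_gt0.
have [z | | z] := @MVT_segment R tan (fun z => (cos z) ^- 2) 0 x x0.
- rewrite in_itv /= => /andP[z0 zx].
  by apply: is_derive_tan; rewrite gt_eqF// cos_pos// ltW.
- apply: continuous_in_subspaceT => z.
  rewrite inE /= in_itv /= => /andP[z0 zx].
  by apply: continuous_tan; rewrite gt_eqF// cos_pos.
rewrite in_itv /= tan0 !subr0 => /andP[z0 zx] ->.
rewrite ler_peMl// invf_ge1 ?exprn_gt0 ?cos_pos//.
Qed.

(** A linear lower bound for the convex function x^(1+s), exact enough at the
    scale t to replace Hoelder's inequality in [sum_power_ge]. *)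
Lemma truncated_power_le (R : realType) (s t x : R) :
  0 <= s -> 0 <= t -> 0 <= x -> t `^ s * (x - t) <= x `^ s * x.
Proof.
move=> s0 t0 x0; have [tx|xt] := leP t x.
  rewrite ler_pM ?powR_ge0 ?subr_ge0//; first by rewrite ge0_ler_powR.
  by rewrite lerBlDr lerDl.
apply: (@le_trans _ _ 0); last by rewrite mulr_ge0 ?powR_ge0.
by rewrite mulr_ge0_le0 ?powR_ge0// subr_le0 ltW.
Qed.

(** Half of the mean value, t = X / (2 M), is the right scale to truncate at:
    the entries below t contribute at most M t = X / 2 to the sum X, and on the
    others |w|^s >= t^s. *)
Lemma sum_power_ge (R : realType) (T : eqType) (A : seq T) (w : T -> R) (s M : R) :
  0 <= s -> 0 < M -> (size A)%:R <= M -> 0 <= \sum_(i <- A) w i ->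
  ((\sum_(i <- A) w i) / (2 * M)) `^ s * ((\sum_(i <- A) w i) / 2)
    <= \sum_(i <- A) `|w i| `^ s * `|w i|.
Proof.
move=> s0 M0 AM.
set X := \sum_(i <- A) w i.
move=> X0; set t := X / (2 * M).
have t0 : 0 <= t by rewrite divr_ge0 ?mulr_ge0// ltW.
have XA : X <= \sum_(i <- A) `|w i| by apply: ler_sum => i _; exact: ler_norm.
apply: (@le_trans _ _ (\sum_(i <- A) t `^ s * (`|w i| - t))); last first.
  by apply: ler_sum => i _; apply: truncated_power_le.
rewrite -mulr_sumr ler_wpM2l ?powR_ge0// sumrB big_const_seq count_predT.
rewrite iter_addr_0 -mulr_natr.
have tA : t * (size A)%:R <= X / 2.
  apply: (@le_trans _ _ (t * M)); first by rewrite ler_wpM2l.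
  by rewrite /t le_eqVlt; apply/orP; left; apply/eqP; field; rewrite gt_eqF.
lra.
Qed.

(** The bound below the threshold keeps the argument of tan in [0, pi/2[, where
    tan x >= x.  Spreading the sum over (C n)^d sites costs the factor
    (n^d)^(-s), which is at least n^(-2) since d s <= 2. *)
Lemma sum_nonlinearity_ge (R : realType) d (s c0 delta : R) (n k C : nat)
    (w : 'rV[int]_d -> R) :
  0 < s -> d%:R * s <= 2 -> 0 < c0 -> 0 < delta -> (0 < n)%N ->
  (k.*2.+1 <= C * n)%N ->
  (forall i, `|w i| < pi / 2 * delta^-1 * n%:R `^ s) ->
  0 <= \sum_(i <- cube d k) w i ->
  (c0 * delta / 2 * ((2 * C%:R ^+ d)^-1) `^ s)
    * ((\sum_(i <- cube d k) w i) / n%:R) `^ s * (\sum_(i <- cube d k) w i)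
    / n%:R ^+ 2
  <= \sum_(i <- cube d k)
       c0 * `|w i| `^ s * tan (delta * (`|w i| / n%:R `^ s)).
Proof.
move=> s0 ds c00 del0 n0 kC below; set X := \sum_(i <- _) w i => X0.
have nR : 0 < n%:R :> R by rewrite ltr0n.
have n1 : 1 <= n%:R :> R by rewrite ler1n.
have ns : 0 < n%:R `^ s by rewrite powR_gt0.
have C0 : 0 < C%:R :> R by rewrite ltr0n; case: (C) kC.
have Cd0 : 0 < C%:R ^+ d :> R by rewrite exprn_gt0.
apply: (@le_trans _ _ (c0 * delta / n%:R `^ s
    * \sum_(i <- cube d k) `|w i| `^ s * `|w i|)); last first.
  rewrite mulr_sumr; apply: ler_sum => i _.
  have -> : c0 * delta / n%:R `^ s * (`|w i| `^ s * `|w i|)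
      = c0 * `|w i| `^ s * (delta * (`|w i| / n%:R `^ s)).
    by field; rewrite gt_eqF.
  rewrite ler_wpM2l ?mulr_ge0 ?powR_ge0// ?(ltW c00)//; apply: tan_ge_id.
    by rewrite mulr_ge0 ?divr_ge0 ?powR_ge0// ltW.
  rewrite mulrA ltr_pdivrMr// mulrC -ltr_pdivlMr//.
  by rewrite mulrAC.
set M : R := C%:R ^+ d * n%:R ^+ d.
have M0 : 0 < M by rewrite mulr_gt0// exprn_gt0.
have AM : (size (cube d k))%:R <= M.
  rewrite size_cube natrX /M -exprMn -natrM lerXn2r ?nnegrE ?ler_nat//.
have := sum_power_ge (ltW s0) M0 AM X0; rewrite -/X => powge.
apply: le_trans (ler_wpM2l _ powge); last first.
  by rewrite ltW// divr_gt0// mulr_gt0.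
have XM : X / (2 * M) = (2 * C%:R ^+ d)^-1 * X * (n%:R ^+ d)^-1.
  by rewrite /M; field; rewrite !gt_eqF// exprn_gt0.
have nds : (n%:R ^+ d) `^ s <= n%:R ^+ 2 :> R.
  by rewrite -!powR_mulrn ?ler0n// -powRrM ler_powR.
have inv_s x : 0 < x -> (x^-1) `^ s = (x `^ s)^-1.
  move=> x0; rewrite -powRN -(powR_inv1 (ltW x0)) -powRrM.
  by rewrite mulN1r.
have Ci0 : 0 <= (2 * C%:R ^+ d)^-1 :> R by rewrite invr_ge0 mulr_ge0// ltW.
rewrite XM !powRM ?mulr_ge0 ?invr_ge0 ?exprn_ge0//; try exact: ltW.
rewrite !inv_s ?exprn_gt0 ?mulr_gt0//.
rewrite [leLHS](_ : _ = c0 * delta / n%:R `^ s * ((2 * C%:R ^+ d) `^ s)^-1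
   * X `^ s * (X / 2) * (n%:R ^+ 2)^-1); last by ring.
rewrite [leRHS](_ : _ = c0 * delta / n%:R `^ s * ((2 * C%:R ^+ d) `^ s)^-1
   * X `^ s * (X / 2) * ((n%:R ^+ d) `^ s)^-1); last by ring.
rewrite ler_wpM2l ?mulr_ge0 ?invr_ge0 ?powR_ge0//; try exact: ltW.
by rewrite lef_pV2 ?posrE ?powR_gt0 ?exprn_gt0.
Qed.

(** * Blow-up *)

Theorem theorem1 (R : realType) (d : nat) (hd : (1 <= d)%N)
    (p : R) (hp1 : 1 < p) (hp2 : p <= 1 + 2 / d%:R)
    (N0 : nat) (hN0 : (0 < N0)%N)
    (delta : R) (hdelta : delta = 1 / N0%:R)
    (h : R) (hh : 0 < h)
    (f g : 'rV[R]_d -> R)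
    (u : nat -> 'rV[int]_d -> R)
    (hu : is_solution N0 delta h p f g u)
    (hsupp : exists2 r : nat, (0 < r)%N &
       [set i : 'rV[int]_d | u N0 i != 0 \/ u N0.+1 i != 0]
         `<=` [set i : 'rV[int]_d | (l1norm i <= r)%N])
    (hsum0 : 0 <= \sum_(i \in [set: 'rV[int]_d]) u N0 i)
    (hsum1 : exists2 I : R, 0 < I &
       I < \sum_(i \in [set: 'rV[int]_d]) (u N0.+1 i - u N0 i)) :
  blows_up N0 delta p u.
Proof.
apply: contrapT => no_blowup.
have below n i : (N0 <= n)%N -> `|u n i| < blowup_threshold delta p n.
  move=> Nn; rewrite ltNge; apply/negP => ge_thr.
  by apply: no_blowup; exists n, i.
have del0 : 0 < delta by rewrite hdelta mul1r invr_gt0 ltr0n.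
have s0 : 0 < p - 1 by rewrite subr_gt0.
have dR : 0 < d%:R :> R by rewrite ltr0n.
have ds : d%:R * (p - 1) <= 2.
  by rewrite mulrC -ler_pdivlMr// lerBlDl.
have s2 : p - 1 <= 2%:R.
  by apply: le_trans ds; rewrite ler_peMl ?(ltW s0)// ler1n.
case: hu => _ _ rec.
set a := delta ^+ 2 / h ^+ 2 in rec.
pose F n (x : R) := delta `^ (2 - p) * `|x| `^ (p - 1)
                    * tan (delta * (`|x| / n%:R `^ (p - 1))).
have F0 n : F n 0 = 0 by rewrite /F normr0 mul0r mulr0 tan0 mulr0.
have {}rec n i : (N0 <= n)%N ->
    u n.+2 i = a * neighbour_sum (u n.+1) i + (2 - 2 * d%:R * a) * u n.+1 i
               - u n i + F n.+1 (u n.+1 i).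
  move=> Nn; rewrite rec// => m /andP[Nm _] j; exact: below.
have [r r0 supp_r] := hsupp.
have supp_init w : (w = u N0 \/ w = u N0.+1) -> supported_in_cube r w.
  move=> w_init i j rj; apply/eqP/negPn/negP => wi.
  have : (l1norm i <= r)%N.
    by apply: supp_r; case: w_init => wE /=; rewrite -wE; [left|right].
  apply/negP; rewrite -ltnNge; apply: (leq_trans rj).
  by rewrite /l1norm (bigD1 j)//= leq_addr.
have supp := finite_propagation F0 rec (supp_init _ (or_introl erefl))
                                (supp_init _ (or_intror erefl)).
pose U n := \sum_(i \in [set: 'rV[int]_d]) u n i.
(* The cubes of radius r + n + 1 at time n, used below, have side
   2 (r + n + 1) + 1, which is at most C n for n >= 1. *)
pose C := (2 * r + 5)%N.
pose c := delta `^ (2 - p) * delta / 2 * ((2 * C%:R ^+ d)^-1) `^ (p - 1).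
have c0 : 0 < c.
  rewrite !mulr_gt0 ?powR_gt0// invr_gt0 mulr_gt0// exprn_gt0//.
  by rewrite ltr0n /C addnS.
apply: (@kato_no_global_solution _ U N0 (d + 2) c (p - 1)
          (C%:R ^+ d * (pi / 2 * delta^-1))) => //.
- have [I I0] := hsum1; move/(lt_trans I0).
  have su0 := supp_init _ (or_introl erefl); have su1 := supp_init _ (or_intror erefl).
  rewrite (@lattice_sumE _ _ r) => [|i j rj]; last first.
    by rewrite (su0 _ _ rj) (su1 _ _ rj) subr0.
  by rewrite sumrB -!(lattice_sumE su0) -!(lattice_sumE su1) subr_gt0.
- move=> n Nn Un.
  have supp0 : supported_in_cube (r + n.+1) (u n).
    by apply: supported_widen (supp _ Nn); rewrite leq_add2l.
  have supp1 := supp _ (leqW Nn).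
  rewrite /U (lattice_sum_second_difference (F0 n.+1) supp0 supp1
               (fun i => rec n i Nn)).
  have supp1' := supported_widen (leqnSn _) supp1.
  rewrite -/(U _) (_ : U n.+1 = \sum_(i <- cube d (r + n.+1).+1) u n.+1 i); last first.
    exact: lattice_sumE.
  apply: sum_nonlinearity_ge => //.
  + by rewrite powR_gt0.
  + by rewrite /C; nia.
  + by move=> i; apply: below; apply: leqW.
  + by rewrite -(lattice_sumE supp1').
- move=> n Nn; rewrite /U (lattice_sumE (supp _ Nn)).
  have n1 : 1 <= n%:R :> R by rewrite ler1n (leq_trans hN0).
  have thr_le : blowup_threshold delta p n <= pi / 2 * delta^-1 * n%:R ^+ 2.
    rewrite /blowup_threshold ler_wpM2l//.
      by rewrite mulr_ge0 ?divr_ge0 ?pi_ge0 ?invr_ge0// ltW.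
    by rewrite -powR_mulrn ?ler0n// ler_powR.
  apply: (@le_trans _ _ (\sum_(i <- cube d (r + n)) pi / 2 * delta^-1 * n%:R ^+ 2)).
    apply: ler_sum => i _; apply: (le_trans (ler_norm _)).
    by apply: le_trans thr_le; apply/ltW/below.
  rewrite big_const_seq count_predT iter_addr_0 -[leLHS]mulr_natl size_cube natrX.
  rewrite exprD [leRHS](_ : _ = (C%:R * n%:R) ^+ d * (pi / 2 * delta^-1 * n%:R ^+ 2)).
    rewrite ler_wpM2r//; first by rewrite mulr_ge0 ?exprn_ge0 ?mulr_ge0 ?pi_ge0 ?invr_ge0// ltW.
    by rewrite lerXn2r ?nnegrE -?natrM ?ler0n// ler_nat /C; nia.
  by rewrite exprMn; ring.
Qed.
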